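(* Let ${\bf C}^{(1)},{\bf C}^{(2)}$ be two independent simple random walks on the 2-dimensional comb lattice $\mathbb{C}^2$, both starting from $(0,0)$, and let $D_2^{\mathbb{C}^2}(n)=d({\bf C}^{(1)}(n),{\bf C}^{(2)}(n))$, where $d$ is the graph distance on $\mathbb{C}^2$. Then for any $\epsilon>0$, $$P\left(D_2^{\mathbb{C}^2}(n)\leq(1+\epsilon)\frac{2^{9/4}}{3^{3/4}}\,n^{1/4}(\log\log n)^{3/4}\ \text{ for infinitely many } n\right)=1.$$
   Context: The 2-dimensional comb lattice $\mathbb{C}^2$ is the graph obtained from the nearest-neighbour lattice $\mathbb{Z}^2$ by removing all horizontal edges off the $x$-axis. The simple random walk ${\bf C}(n)=(C_1(n),C_2(n))$ on $\mathbb{C}^2$ has transition probabilities $P({\bf C}(n+1)=(x,y\pm1)\mid{\bf C}(n)=(x,y))=\frac12$ if $y\neq0$, and $P({\bf C}(n+1)=(x\pm1,0)\mid{\bf C}(n)=(x,0))=P({\bf C}(n+1)=(x,\pm1)\mid{\bf C}(n)=(x,0))=\frac14$ (each of the indicated neighbours having the given probability). The graph distance $d(u,v)$ is the length of the shortest path in $\mathbb{C}^2$ from $u$ to $v$. *)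

(* Defs.v *)
From HB Require Import structures.
From mathcomp Require Import all_boot all_order all_algebra.
From mathcomp Require Import zify.
From mathcomp Require Import all_classical all_reals all_analysis.
Set Implicit Arguments.
Unset Strict Implicit.
Unset Printing Implicit Defensive.
Import Order.TTheory GRing.Theory Num.Theory.
Local Open Scope classical_set_scope.
Local Open Scope ring_scope.

Section GraphDistance.
Variables (V : eqType) (e : rel V).

Definition walk_of_length (u v : V) (k : nat) : Prop :=
  exists p : seq V, [/\ path e u p, last u p = v & size p = k].

(* The default value 0 of [xget] is reached only when u and v are not joined
   by any walk; see [graph_distP] and [comb_connected]. *)
Definition graph_dist (u v : V) : nat :=
  xget 0%N [set k | walk_of_length u v k /\
                    forall k', walk_of_length u v k' -> (k <= k')%N].

Lemma graph_distP u v : (exists k, walk_of_length u v k) ->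
  walk_of_length u v (graph_dist u v) /\
  forall k, walk_of_length u v k -> (graph_dist u v <= k)%N.
Proof.
move=> ex; rewrite /graph_dist.
case: xgetP => [k _ //|nok].
have exb : exists k, `[< walk_of_length u v k >].
  by case: ex => k ?; exists k; apply/asboolP.
case: (ex_minnP exb) => k /asboolP wk mink.
case: (nok k); split=> // k' wk'.
by apply: mink; apply/asboolP.
Qed.

Lemma walk_trans u v w : (exists k, walk_of_length u v k) ->
  (exists k, walk_of_length v w k) -> exists k, walk_of_length u w k.
Proof.
move=> [_ [p [pp <- _]]] [_ [q [pq <- _]]].
exists (size (p ++ q)), (p ++ q); split=> //; last by rewrite last_cat.
by rewrite cat_path pp.
Qed.

End GraphDistance.

Definition vertex : Type := (int * int)%type.

Definition grid_adj : rel vertex :=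
  fun u v => `|u.1 - v.1| + `|u.2 - v.2| == 1.

Definition comb_adj : rel vertex :=
  fun u v => grid_adj u v && ~~ ((u.2 == v.2) && (u.2 != 0)).

Definition comb_dist : vertex -> vertex -> nat := graph_dist comb_adj.

Lemma comb_adj_sym u v : comb_adj u v = comb_adj v u.
Proof.
rewrite /comb_adj /grid_adj (distrC u.1) (distrC u.2) (eq_sym u.2).
by case: (eqVneq v.2 u.2) => // ->.
Qed.

Lemma comb_walk_sym u v : (exists k, walk_of_length comb_adj u v k) ->
  exists k, walk_of_length comb_adj v u k.
Proof.
move=> [k [p [pp <- _]]]; elim: p u pp => [|w p IH] u /=.
  by exists 0%N, [::].
move=> /andP[uw /IH wp]; apply: walk_trans wp _.
by exists 1%N, [:: u]; split=> //=; rewrite comb_adj_sym uw.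
Qed.

Lemma comb_connected u v : exists k, walk_of_length comb_adj u v k.
Proof.
have step a b : comb_adj a b -> exists k, walk_of_length comb_adj a b k.
  by exists 1%N, [:: b]; split=> //=; rewrite andbT.
suff to0 w : exists k, walk_of_length comb_adj w (0, 0) k.
  by apply: walk_trans (to0 u) (comb_walk_sym (to0 v)).
case: w => x y; apply: (@walk_trans _ _ _ (x, 0)).
  elim: y => [|n IH|n IH]; first by exists 0%N, [::].
    apply: walk_trans IH; apply: step.
    by rewrite /comb_adj /grid_adj /=; lia.
  apply: walk_trans IH; apply: step.
  by rewrite /comb_adj /grid_adj /=; lia.
elim: x => [|n IH|n IH]; first by exists 0%N, [::].
  apply: walk_trans IH; apply: step.
  by rewrite /comb_adj /grid_adj /=; lia.
apply: walk_trans IH; apply: step.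
by rewrite /comb_adj /grid_adj /=; lia.
Qed.

Definition comb_trans (R : realType) (u v : vertex) : R :=
  let: (x, y) := u in
  if y != 0 then
    if v \in [:: (x, y + 1); (x, y - 1)] then 1 / 2 else 0
  else
    if v \in [:: (x + 1, 0); (x - 1, 0); (x, 1); (x, -1)] then 1 / 4 else 0.

Section CombWalk.
Context (d : measure_display) (T : measurableType d) (R : realType).
Variable P : probability T R.

Definition path_event (C : nat -> T -> vertex) (z : nat -> vertex) (n : nat)
    : set T :=
  [set w | forall k, (k <= n)%N -> C k w = z k].

(* The transition condition is
   P(C (n+1) = z (n+1) | C 0 = z 0, ..., C n = z n) = p(z n, z (n+1)),
   multiplied out so that no division by a null probability occurs. *)
Definition comb_walk (C : nat -> T -> vertex) : Prop :=
  [/\ forall n z, measurable (C n @^-1` [set z]),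
      P (C 0%N @^-1` [set (0, 0)]) = 1%E &
      forall n z, P (path_event C z n.+1) =
        (P (path_event C z n) * (comb_trans R (z n) (z n.+1))%:E)%E].

Definition sigma_process (C : nat -> T -> vertex) : set (set T) :=
  <<s [set A | exists n z, A = C n @^-1` [set z]] >>.

Definition independent_processes (C1 C2 : nat -> T -> vertex) : Prop :=
  forall A B, sigma_process C1 A -> sigma_process C2 B ->
    P (A `&` B) = (P A * P B)%E.

End CombWalk.

(* Main.v *)
(* At times when both walks are on the horizontal axis their distance is the
   horizontal gap [|x1 - x2|], so it suffices to show that such times recur and
   that the gap at all large such times is at most 2 n^(1/4) (ln ln n)^(3/4);
   note that 2^(9/4) / 3^(3/4) >= 2.

   Recurrence.  The pair of vertical coordinates is a product chain, so its
   return probabilities are the squares p_n^2 of those of one coordinate y.  Since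
   E|y_n| is half the expected number of visits to 0 before time n, the second and
   fourth moments of y pin p_0 + ... + p_(n-1) between multiples of sqrt n; hence
   each block 36^j <= n < 36^(j+1) contributes a fixed amount to the sum of p_n^2,
   which diverges.

   Gap.  For small t and a slightly above t^2/2, [exp (t x - a |y|)] grows in mean
   by at most a factor [exp (3/16 t^4)] per step of one walk, which makes
   [cosh (t (x1 - x2)) exp (- a (|y1| + |y2|))], suitably discounted, a
   supermartingale.  With t^4 = (ln ln n) / n, the probability that the gap
   exceeds the above bound on the axis during [n, 2 n] is O((ln n)^(-5/4)), which
   is summable over n = 2^j. *)

Require Import Defs.
From mathcomp Require Import all_boot all_order all_algebra.
From mathcomp Require Import all_classical all_reals all_analysis.
From mathcomp Require Import ring lra zify.
Import Order.TTheory GRing.Theory Num.Theory.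
Local Open Scope classical_set_scope.
Local Open Scope ring_scope.

(** * Averaging operators of chains driven by uniformly chosen moves *)

Section AveragingOperator.
Context {R : realType} {I : finType} {V : eqType} (mv : V -> I -> V).
Implicit Types (f g : V -> R) (A : nat -> pred V) (u o : V).

(** The one-step transition operator; unequal transition weights arise when several moves lead to
    the same vertex. *)
Definition step f u : R := (\sum_i f (mv u i)) / #|I|%:R.

(* [stay A m k u] is the probability that the chain which is at [u] at time [k]
   lies in [A j] for all [j] between [k] and [k + m]. *)
Fixpoint stay A (m k : nat) u : R :=
  (A k u)%:R * (if m is m'.+1 then step (stay A m' k.+1) u else 1).

Lemma step_le f g u : (forall v, f v <= g v) -> step f u <= step g u.
Proof. by move=> fg; rewrite ler_wpM2r ?invr_ge0 ?ler0n// ler_sum. Qed.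

Lemma stepD f g u : step (fun v => f v + g v) u = step f u + step g u.
Proof. by rewrite /step big_split/= mulrDl. Qed.

Lemma stepZ c f u : step (fun v => c * f v) u = c * step f u.
Proof. by rewrite /step -mulr_sumr mulrA. Qed.

Lemma step_ext f g : f =1 g -> step f =1 step g.
Proof. by move=> fg u; congr (_ / _); apply: eq_bigr => i _. Qed.

Lemma step_ge0 f u : (forall v, 0 <= f v) -> 0 <= step f u.
Proof. by move=> f0; rewrite divr_ge0 ?ler0n// sumr_ge0. Qed.

Lemma stay_ge0 A m k u : 0 <= stay A m k u.
Proof.
elim: m k u => [|m IH] k u /=; rewrite mulr_ge0 ?ler0n//.
by apply: step_ge0.
Qed.

Lemma stay_ext A A' m k u : (forall j v, A j v = A' j v) ->
  stay A m k u = stay A' m k u.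
Proof.
move=> AA; elim: m k u => [|m IH] k u /=; rewrite AA//.
by congr (_ * _); apply: step_ext => v; apply: IH.
Qed.

Lemma stay_homogeneous (B : pred V) m k k' u :
  stay (fun=> B) m k u = stay (fun=> B) m k' u.
Proof.
elim: m k k' u => [|m IH] k k' u //=.
by congr (_ * _); apply: step_ext => v; apply: IH.
Qed.

(** During the first [N] steps the constraint is vacuous, so they act as plain averages. *)
Lemma stay_delayed A N m k u :
  stay (fun j v => (j < k + N)%N || A j v) (N + m) k u =
  iter N step (stay A m (k + N)) u.
Proof.
elim: N k u => [|N IH] k u.
  have aux j : (k <= j)%N -> forall v,
      stay (fun i w => (i < k)%N || A i w) m j v = stay A m j v.
    elim: m j => [|m IH] j kj v /=; rewrite ltnNge kj //=.
    by congr (_ * _); apply: step_ext => w; apply: IH; lia.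
  by rewrite !addn0 aux.
rewrite addSn iterS /= -addSnnS.
have -> : (k < k.+1 + N)%N by lia.
by rewrite mul1r; apply: step_ext => v; apply: IH.
Qed.

Hypothesis I0 : (0 < #|I|)%N.

Lemma step_cst c u : step (fun=> c) u = c.
Proof.
rewrite /step sumr_const -(mulr_natr c) -mulrA divff ?mulr1//.
by rewrite pnatr_eq0 -lt0n.
Qed.

Lemma stay_le1 A m k u : stay A m k u <= 1.
Proof.
elim: m k u => [|m IH] k u /=; first by rewrite mulr1 lern1 leq_b1.
rewrite mulr_ile1 ?ler0n ?lern1 ?leq_b1//.
  by apply: step_ge0 => v; apply: stay_ge0.
by rewrite -(step_cst 1 u) step_le.
Qed.

(** Ville's maximal inequality, by recursion on the first step: outside [A] the bound is that [M] is
    at least 1, inside [A] it is averaged over the next move. *)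
Lemma stay_supermartingale (M : nat -> V -> R) A n m k u :
  (k + m = n)%N -> (forall j v, 0 <= M j v) ->
  (forall j v, (j < n)%N -> step (M j.+1) v <= M j v) ->
  (forall j v, (j <= n)%N -> ~~ A j v -> 1 <= M j v) ->
  1 - stay A m k u <= M k u.
Proof.
move=> kmn M0 Msup M1; elim: m k kmn u => [|m IH] k kmn u /=.
  case: (boolP (A k u)) => Aku; rewrite ?mul0r ?mul1r ?subrr ?subr0//.
  by apply: M1; rewrite // -kmn leq_addr.
case: (boolP (A k u)) => Aku; last first.
  by rewrite mul0r subr0 M1// -kmn leq_addr.
rewrite mul1r; apply: le_trans (Msup k u _); last by lia.
rewrite -{1}(step_cst 1 u) -[in leLHS](mulN1r (step _ _)) -stepZ -stepD.
by apply: step_le => v; rewrite mulN1r; apply: IH; lia.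
Qed.

Lemma iter_stepD n f g u :
  iter n step (fun v => f v + g v) u = iter n step f u + iter n step g u.
Proof.
elim: n u => // n IH u; rewrite !iterS -stepD; exact: step_ext.
Qed.

Lemma iter_stepZ n c f u :
  iter n step (fun v => c * f v) u = c * iter n step f u.
Proof. elim: n u => // n IH u; rewrite !iterS -stepZ; exact: step_ext. Qed.

Lemma iter_step_le n f g u : (forall v, f v <= g v) ->
  iter n step f u <= iter n step g u.
Proof. by move=> fg; elim: n u => // n IH u; rewrite !iterS step_le. Qed.

Lemma iter_step_ext n f g : f =1 g -> iter n step f =1 iter n step g.
Proof. by move=> fg; elim: n => // n IH; apply: step_ext. Qed.

Lemma iter_step_cst n c u : iter n step (fun=> c) u = c.
Proof.
elim: n u => // n IH u; rewrite iterS -[RHS](step_cst c u); exact: step_ext.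
Qed.

Lemma iter_step_ge0 n f u : (forall v, 0 <= f v) -> 0 <= iter n step f u.
Proof. by move=> f0; rewrite -(iter_step_cst n 0 u) iter_step_le. Qed.

(** * Recurrence from divergence of the expected number of visits *)

Section Recurrence.
Variable o : V.

Definition avoid (m : nat) : V -> R := stay (fun _ v => v != o) m 0.

Definition return_prob (n : nat) : R := iter n step (fun v => (v == o)%:R) o.

(** One step precedes the constraint, so this is the probability of no return to [o] at times 1 to m
    + 1. *)
Definition escape (m : nat) : R := step (avoid m) o.

Lemma avoidS m u : avoid m.+1 u = (u != o)%:R * step (avoid m) u.
Proof.
by congr (_ * _); apply: step_ext => v; apply: stay_homogeneous.
Qed.

Lemma avoid_o m : avoid m o = 0.
Proof. by rewrite /avoid; case: m => [|m] /=; rewrite eqxx mul0r. Qed.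

Lemma escape_ge0 m : 0 <= escape m.
Proof. by apply: step_ge0 => v; apply: stay_ge0. Qed.

Lemma return_prob_ge0 n : 0 <= return_prob n.
Proof. by apply: iter_step_ge0 => v; rewrite ler0n. Qed.

Lemma return_prob_le1 n : return_prob n <= 1.
Proof.
rewrite -(iter_step_cst n 1 o); apply: iter_step_le => v.
by rewrite lern1 leq_b1.
Qed.

Lemma avoid_nonincreasing m n u : (m <= n)%N -> avoid n u <= avoid m u.
Proof.
elim: m n u => [|m IH] [|n] u //=.
  move=> _; rewrite avoidS {2}/avoid /=; apply: ler_wpM2l; first exact: ler0n.
  by rewrite -[leRHS](step_cst 1 u) step_le// => v; apply: stay_le1.
rewrite ltnS => mn; rewrite !avoidS; apply: ler_wpM2l; first exact: ler0n.
by apply: step_le => v; apply: IH.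
Qed.

Lemma escape_nonincreasing m n : (m <= n)%N -> escape n <= escape m.
Proof. by move=> mn; apply: step_le => v; apply: avoid_nonincreasing. Qed.

(* Decomposition according to the last visit to [o] before time [N]. *)
Lemma last_visit N m :
  iter N step (avoid m) o =
  \sum_(n < N) escape (m + (N - n.+1)) * return_prob n.
Proof.
elim: N m => [|N IH] m; first by rewrite big_ord0 /= avoid_o.
rewrite big_ord_recr /= subnn addn0 -iterS iterSr.
(* [step (avoid m)] and [avoid m.+1] differ only at [o], where the latter vanishes. *)
have E : step (avoid m) =1
    (fun v => avoid m.+1 v + escape m * (v == o)%:R).
  move=> v; rewrite avoidS /escape; case: eqP => [->|_] /=.
    by rewrite mul0r mulr1 add0r.
  by rewrite mul1r mulr0 addr0.
rewrite (iter_step_ext N _ _ E) iter_stepD iter_stepZ IH; congr (_ + _).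
by apply: eq_bigr => i _; congr (escape _ * _); have := ltn_ord i; lia.
Qed.

(** In the last-visit decomposition every escape factor is at least [escape N], and the total is a
    probability. *)
Lemma escape_sum N : escape N * \sum_(n < N) return_prob n <= 1.
Proof.
apply: (@le_trans _ _ (iter N step (avoid 0) o)); last first.
  rewrite -(iter_step_cst N 1 o) iter_step_le// => v; exact: stay_le1.
rewrite last_visit mulr_sumr ler_sum// => i _.
by rewrite ler_wpM2r ?return_prob_ge0// escape_nonincreasing//; have := ltn_ord i; lia.
Qed.

Lemma avoid_after N m : iter N step (avoid m) o <= N%:R * escape m.
Proof.
rewrite last_visit mulr_natl -[X in _ *+ X]card_ord -sumr_const ler_sum// => i _.
apply: (@le_trans _ _ (escape m * 1)); last by rewrite mulr1.
apply: ler_pM; rewrite ?escape_ge0 ?return_prob_ge0 ?return_prob_le1//.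
by rewrite escape_nonincreasing ?leq_addr.
Qed.

(** Divergence forces [escape] to 0 by [escape_sum]; [avoid_after] transfers this to a chain that
    has first moved freely for [N] steps. *)
Lemma recurrent_avoid (N : nat) (delta : R) : 0 < delta ->
  (forall B, exists n, B <= \sum_(k < n) return_prob k) ->
  exists m0, forall m, (m0 <= m)%N -> iter N step (avoid m) o <= delta.
Proof.
(* [N + 1] instead of [N] keeps this level positive when [N] is 0. *)
move=> d0 div; have [n Bn] := div ((N.+1)%:R / delta).
exists n => m nm; apply: le_trans (avoid_after N m) _.
have Bp : 0 < (N.+1)%:R / delta :> R by rewrite divr_gt0// ltr0n.
have en : escape n * ((N.+1)%:R / delta) <= 1.
  by apply: le_trans (escape_sum n); rewrite ler_wpM2l ?escape_ge0.
have em : escape m <= delta / (N.+1)%:R.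
  apply: le_trans (escape_nonincreasing _ _ nm) _.
  by rewrite -(invf_div N.+1%:R) -div1r ler_pdivlMr.
apply: (@le_trans _ _ (N%:R * (delta / (N.+1)%:R))).
  by rewrite ler_wpM2l ?ler0n.
rewrite mulrCA ger_pMr// ler_pdivrMr ?ltr0n// mul1r ler_nat; lia.
Qed.

End Recurrence.

End AveragingOperator.

(** * Projections and products of chains *)

Section ProjectionAndProduct.
Context {R : realType}.

Lemma step_proj {I : finType} {V V' : eqType} (mv : V -> I -> V)
    (mv' : V' -> I -> V') (pi : V -> V') (f : V' -> R) u :
  (forall u i, pi (mv u i) = mv' (pi u) i) ->
  step mv (fun v => f (pi v)) u = step mv' f (pi u).
Proof. by move=> H; congr (_ / _); apply: eq_bigr => i _; rewrite H. Qed.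

Lemma stay_proj {I : finType} {V V' : eqType} (mv : V -> I -> V)
    (mv' : V' -> I -> V') (pi : V -> V') (A : nat -> pred V') m k u :
  (forall u i, pi (mv u i) = mv' (pi u) i) ->
  stay mv (fun j v => A j (pi v)) m k u = stay mv' A m k (pi u) :> R.
Proof.
move=> H; elim: m k u => [|m IH] k u //=; congr (_ * _).
by rewrite -(step_proj _ _ _ _ _ H); apply: step_ext.
Qed.

Definition prod_move {I1 I2 : finType} {V1 V2 : eqType}
    (mv1 : V1 -> I1 -> V1) (mv2 : V2 -> I2 -> V2) (u : V1 * V2) (i : I1 * I2) :=
  (mv1 u.1 i.1, mv2 u.2 i.2).

Lemma step_prod {I1 I2 : finType} {V1 V2 : eqType}
    (mv1 : V1 -> I1 -> V1) (mv2 : V2 -> I2 -> V2) (f : V1 -> R) (g : V2 -> R) u :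
  step (prod_move mv1 mv2) (fun v => f v.1 * g v.2) u =
  step mv1 f u.1 * step mv2 g u.2.
Proof.
rewrite /step card_prod natrM invfM mulrACA; congr (_ * _).
rewrite big_distrlr /= pair_big/=; exact: eq_bigr.
Qed.

Lemma return_prob_prod {I1 I2 : finType} {V1 V2 : eqType}
    (mv1 : V1 -> I1 -> V1) (mv2 : V2 -> I2 -> V2) o1 o2 n :
  return_prob (prod_move mv1 mv2) (o1, o2) n =
  return_prob mv1 o1 n * return_prob mv2 o2 n :> R.
Proof.
rewrite /return_prob.
have E : forall u, iter n (step (prod_move mv1 mv2))
    (fun v => (v == (o1, o2))%:R) u =
    iter n (step mv1) (fun v => (v == o1)%:R) u.1 *
    iter n (step mv2) (fun v => (v == o2)%:R) u.2 :> R.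
  elim: n => [|n IH] u /=; first by case: u => a b; rewrite xpair_eqE -mulnb natrM.
  by rewrite (step_ext _ _ _ IH) step_prod.
exact: (E (o1, o2)).
Qed.

End ProjectionAndProduct.

(** Regroups the moves by endpoint; duplicates are removed because several moves may share one. *)
Lemma step_transition {R : realType} {I : finType} {V : eqType}
    (mv : V -> I -> V) (g : V -> R) u :
  \sum_(v <- undup [seq mv u i | i : I]) step mv (fun w => (w == v)%:R) u * g v =
  step mv g u.
Proof.
rewrite /step mulr_suml.
under eq_bigr => v _ do rewrite mulrAC !mulr_suml.
rewrite exchange_big /=; apply: eq_bigr => i _.
rewrite (bigD1_seq (mv u i)) ?undup_uniq ?mem_undup//=; last exact: codom_f.
by rewrite eqxx mul1r big1 ?addr0// => v /negbTE nv; rewrite eq_sym nv !mul0r.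
Qed.

(** * From the transition law of a process to its stay probabilities *)

Section MarkovChain.
Context {d : measure_display} {T : measurableType d} {R : realType}.
Variable P : probability T R.
Context {I : finType} {V : countType} (mv : V -> I -> V) (o : V).
Hypothesis I0 : (0 < #|I|)%N.
Variable Z : nat -> T -> V.

Definition path_set (z : nat -> V) (n : nat) : set T :=
  [set w | forall k, (k <= n)%N -> Z k w = z k].

Definition stay_set (A : nat -> pred V) (k m : nat) : set T :=
  [set w | forall j, (k <= j <= k + m)%N -> A j (Z j w)].

Hypothesis mZ : forall n v, measurable (Z n @^-1` [set v]).

(** The state space is countable, so the event is a countable union of fibres. *)
Lemma measurable_chain n (B : V -> Prop) : measurable [set w | B (Z n w)].
Proof.
have -> : [set w | B (Z n w)] =
    \bigcup_v (if `[< B v >] then Z n @^-1` [set v] else set0).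
  apply/seteqP; split => w /=.
    by move=> Bw; exists (Z n w) => //; case: asboolP.
  by move=> [v _]; case: asboolP => // Bv /= ->.
apply: countable_bigcupT_measurable; first exact: countableP.
by move=> v; case: ifP.
Qed.

Lemma measurable_path_set z n : measurable (path_set z n).
Proof.
have -> : path_set z n = \bigcap_(k in [set k | (k <= n)%N]) (Z k @^-1` [set z k]).
  by apply/seteqP; split => w /=.
by apply: bigcap_measurableType.
Qed.

Lemma measurable_stay_set A k m : measurable (stay_set A k m).
Proof.
have -> : stay_set A k m =
    \bigcap_(j in [set j | (k <= j <= k + m)%N]) [set w | A j (Z j w)].
  by apply/seteqP; split => w /=.
apply: bigcap_measurableType => j _; exact: (measurable_chain j (fun v => A j v)).
Qed.

Hypothesis Z0 : P (Z 0%N @^-1` [set o]) = 1%E.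
Hypothesis Zstep : forall n z, P (path_set z n.+1) =
  (P (path_set z n) * (step mv (fun v => (v == z n.+1)%:R) (z n))%:E)%E.

(** The Markov property: the history [z] is extended by each possible next state, and the induction
    hypothesis applies to each extension. *)
Lemma path_stay A m k z :
  P (path_set z k `&` stay_set A k m) =
  (P (path_set z k) * (stay mv A m k (z k))%:E)%E.
Proof.
elim: m k z => [|m IH] k z.
  case: (boolP (A k (z k))) => Akz; rewrite /stay ?Akz ?(negbTE Akz) /=.
    rewrite mulr1 mule1; congr (P _); apply/seteqP; split => w /=; first by case.
    move=> zw; split => // j; rewrite addn0 => kj.
    by have -> : j = k; [lia | rewrite zw].
  rewrite mul0r mule0 -[RHS](measure0 P); congr (P _); apply/seteqP; split => w //=.
  move=> [zw /(_ k)]; rewrite addn0 leqnn => /(_ isT).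
  by rewrite zw// (negbTE Akz).
case: (boolP (A k (z k))) => Akz; rewrite /= ?Akz ?(negbTE Akz) /=; last first.
  rewrite mul0r mule0 -[RHS](measure0 P); congr (P _); apply/seteqP; split => w //=.
  move=> [zw /(_ k)]; rewrite leqnn leq_addr => /(_ isT).
  by rewrite zw// (negbTE Akz).
rewrite mul1r.
pose zv v j := if j == k.+1 then v else z j.
pose N := undup [seq mv (z k) i | i : I].
(* Jumps to a state outside [N] are not impossible, only null; [U] discards them. *)
pose U := \bigcup_(v in [set` N]) path_set (zv v) k.+1.
have mU : measurable U.
  apply: fin_bigcup_measurable => [|v _]; first exact: finite_seq.
  exact: measurable_path_set.
have zvk v j : (j <= k)%N -> zv v j = z j by rewrite /zv; case: eqP => // ->; lia.
have zvS v : zv v k.+1 = v by rewrite /zv eqxx.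
have Pzv v : P (path_set (zv v) k.+1) =
    (P (path_set z k) * (step mv (fun w => (w == v)%:R) (z k))%:E)%E.
  rewrite Zstep zvS zvk//; congr (P _ * _)%E; apply/seteqP; split => w /= zw j jk;
  by rewrite zw// zvk.
have [p Pp] : exists p : R, P (path_set z k) = p%:E.
  exists (fine (P (path_set z k))); rewrite fineK//.
  exact/fin_num_measure/measurable_path_set.
have sumN G : (forall v, measurable (G v)) ->
    (forall v, G v `<=` path_set (zv v) k.+1) ->
    P (\bigcup_(v in [set` N]) G v) = (\sum_(v <- N) P (G v))%E.
  move=> mG sG; rewrite measure_fin_bigcup//.
  - by rewrite -fsbig_seq// undup_uniq.
  - exact: finite_seq.
  - move=> v v' _ _ [w [/sG /(_ k.+1 (leqnn _)) + /sG /(_ k.+1 (leqnn _))]].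
    by rewrite !zvS => -> ->.
have PU : P U = P (path_set z k).
  rewrite (sumN (fun v => path_set (zv v) k.+1)); last 2 first.
  - by move=> v; exact: measurable_path_set.
  - by move=> v.
  under eq_bigr => v _ do rewrite Pzv Pp -EFinM.
  rewrite sumEFin Pp -mulr_sumr; congr (_%:E).
  rewrite -[RHS]mulr1 -[X in _ = _ * X](step_cst mv I0 1 (z k)) -step_transition.
  by congr (_ * _); apply: eq_bigr => v _; rewrite mulr1.
have UZ : U `<=` path_set z k.
  by move=> w [v _ zw] j jk /=; rewrite zw ?zvk//; lia.
set E := path_set z k `&` _.
have mE : measurable E.
  by apply: measurableI; [exact: measurable_path_set | exact: measurable_stay_set].
have EU0 : P (E `\` U) = 0%E.
  apply/eqP; rewrite -measure_le0.
  apply: (@le_trans _ _ (P (path_set z k `\` U))).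
    apply: le_measure; rewrite ?inE; [exact: measurableD | | ].
      by apply: measurableD => //; exact: measurable_path_set.
    by move=> w [[]].
  have mz := measurable_path_set z k.
  have zoo : (P (path_set z k) < +oo)%E by rewrite Pp ltry.
  by rewrite (measureD mz mU zoo) (setIidr UZ) [X in (_ - X)%E]PU [X in (X - _)%E]Pp Pp subee.
transitivity (P (E `&` U)).
  by rewrite (measureDI _ mE mU) [X in (X + _)%E]EU0 add0e.
have -> : E `&` U =
    \bigcup_(v in [set` N]) (path_set (zv v) k.+1 `&` stay_set A k.+1 m).
  apply/seteqP; split => w /=.
    move=> [[_ sw] [v vN zw]]; exists v => //; split => // j kj.
    by apply: sw; lia.
  move=> [v vN [zw sw]]; split; last by exists v.
  have zw' : path_set z k w by apply: UZ; exists v.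
  split => // j kj; have [jk|jk] := leqP j k.
    by have -> : j = k; [lia | rewrite zw'].
  by apply: sw; lia.
rewrite (sumN (fun v => path_set (zv v) k.+1 `&` stay_set A k.+1 m)); last 2 first.
- by move=> v; apply: measurableI; [exact: measurable_path_set
    | exact: measurable_stay_set].
- by move=> v w [].
rewrite Pp -EFinM -step_transition mulr_sumr -sumEFin; apply: eq_bigr => v _.
by rewrite IH Pzv zvS Pp mulrA.
Qed.

Lemma stay_probability A m : P (stay_set A 0 m) = (stay mv A m 0 o)%:E.
Proof.
have mo := measurable_path_set (fun=> o) 0; have mS := measurable_stay_set A 0 m.
have Po : P (path_set (fun=> o) 0) = 1%E.
  rewrite -Z0; congr (P _); apply/seteqP; split => w /=; first exact.
  by move=> zw [].
(* The chain starts at [o] only almost surely, so a null event is removed first. *)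
transitivity (P (path_set (fun=> o) 0 `&` stay_set A 0 m)); last first.
  by rewrite path_stay Po mul1e.
rewrite (measureDI _ mS mo) setIC.
rewrite [X in (X + _)%E](_ : _ = 0%E) ?add0e//.
apply/eqP; rewrite -measure_le0.
apply: (@le_trans _ _ (P (~` path_set (fun=> o) 0))).
  apply: le_measure; rewrite ?inE; [exact: measurableD | exact: measurableC | ].
  by move=> w [].
by rewrite probability_setC// Po subee.
Qed.

End MarkovChain.

(** * The comb walk as a chain with four moves *)

(* The comb walk chooses uniformly among four moves; off the axis each of the two
   vertical moves is listed twice. *)
Definition vert_move (y : int) (i : 'I_4) : int :=
  if y != 0 then (if (i < 2)%N then y + 1 else y - 1)
  else nth 0 [:: 0; 0; 1; -1] i.

Definition comb_move (u : vertex) (i : 'I_4) : vertex :=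
  if u.2 != 0 then (u.1, if (i < 2)%N then u.2 + 1 else u.2 - 1)
  else nth (0, 0) [:: (u.1 + 1, 0); (u.1 - 1, 0); (u.1, 1); (u.1, -1)] i.

Lemma comb_move_vert u i : (comb_move u i).2 = vert_move u.2 i.
Proof.
rewrite /comb_move /vert_move; case: ifP => //= _.
by case: i => [[|[|[|[|i]]]] Hi].
Qed.

Section CombMoves.
Context {R : realType}.

Lemma step_vert (f : int -> R) y : step vert_move f y =
  if y != 0 then (f (y + 1) + f (y - 1)) / 2
  else f 0 / 2 + (f 1 + f (-1)) / 4.
Proof.
rewrite /step card_ord !big_ord_recl big_ord0 /vert_move /=.
by case: ifP => _; field.
Qed.

Lemma step_comb (f : vertex -> R) u : step comb_move f u =
  if u.2 != 0 then (f (u.1, u.2 + 1) + f (u.1, u.2 - 1)) / 2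
  else (f (u.1 + 1, 0) + f (u.1 - 1, 0) + f (u.1, 1) + f (u.1, -1)) / 4.
Proof.
rewrite /step card_ord !big_ord_recl big_ord0 /comb_move /=.
by case: ifP => _; field.
Qed.

(** The listed neighbours are distinct, so membership in the list is a sum of indicators. *)
Lemma comb_transE u v :
  comb_trans R u v = step comb_move (fun w => (w == v)%:R) u.
Proof.
have count s : uniq s -> (v \in s)%:R = (count_mem v s)%:R :> R.
  by move=> us; rewrite count_uniq_mem.
rewrite step_comb; case: u => x y; rewrite /comb_trans /=.
case: eqP => [->|_] /=; rewrite -[if _ then _ else _]mul1r -mulrb mulrnAr -mulrnAl.
  have := count [:: (x + 1, 0); (x - 1, 0); (x, 1); (x, -1)].
  rewrite /= !inE !xpair_eqE => H; rewrite H; last by lia.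
  by rewrite !natrD; lra.
have := count [:: (x, y + 1); (x, y - 1)].
rewrite /= !inE !xpair_eqE => H; rewrite H; last by lia.
by rewrite !natrD; lra.
Qed.

End CombMoves.

(** * Moments of the vertical coordinate and divergence of the pair's visits *)

Section VerticalMoments.
Context {R : realType}.

Local Notation expect n f := (iter n (step vert_move) f 0 : R).
Local Notation visits n := (\sum_(0 <= k < n) (return_prob vert_move 0 k : R)).

Let I4 : (0 < #|'I_4|)%N. Proof. by rewrite card_ord. Qed.

(** A discrete Tanaka formula: [|y|] is preserved in mean off 0 and gains 1/2 at 0. *)
Lemma expect_abs n : expect n (fun y => `|y|%:~R) = visits n / 2.
Proof.
elim: n => [|n IH]; first by rewrite big_geq//= mul0r.
rewrite big_nat_recr//= -iterS iterSr.
rewrite (@iter_step_ext _ _ _ _ _ _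
  (fun y => `|y|%:~R + (1 / 2) * (y == 0)%:R)); last first.
  move=> y; rewrite step_vert; case: eqVneq => [->|y0] /=.
    by rewrite normrN normr0 normr1; lra.
  rewrite -intrD.
  have -> : `|y + 1| + `|y - 1| = `|y| * 2 :> int by lia.
  by rewrite intrM; lra.
by rewrite iter_stepD iter_stepZ IH /return_prob; lra.
Qed.

(** The mean increment of y^2 is 1 off 0, but 1/2 at 0, where the walk stays put half of the
    time. *)
Lemma expect_sqr n : expect n (fun y => (y%:~R) ^+ 2) = n%:R - visits n / 2.
Proof.
elim: n => [|n IH]; first by rewrite big_geq//= expr0n/= mul0r subr0.
rewrite big_nat_recr//= -iterS iterSr.
rewrite (@iter_step_ext _ _ _ _ _ _
  (fun y => (y%:~R) ^+ 2 + (1 + (- (1 / 2)) * (y == 0)%:R))); last first.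
  move=> y; rewrite step_vert; case: eqVneq => [->|y0] /=; first by lra.
  by rewrite !intrD; lra.
rewrite !iter_stepD iter_stepZ iter_step_cst// IH /return_prob -natr1; lra.
Qed.

(** The mean increment of y^4 is at most 6 y^2 + 1, and the second moment at time n is at most n. *)
Lemma expect_fourth n : expect n (fun y => (y%:~R) ^+ 4) <= 3 * n%:R ^+ 2.
Proof.
elim: n => [|n IH] /=; first by rewrite !expr0n/= mulr0.
rewrite -iterS iterSr.
apply: (@le_trans _ _ (expect n (fun y => (y%:~R) ^+ 4 + (6 * (y%:~R) ^+ 2 + 1)))).
  apply: iter_step_le => y; rewrite step_vert; case: eqVneq => [->|y0] /=.
    by lra.
  by rewrite !intrD; lra.
rewrite !iter_stepD iter_stepZ iter_step_cst// expect_sqr -natr1.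
have v0 : 0 <= visits n by apply: sumr_ge0 => k _; exact: return_prob_ge0.
by nra.
Qed.

(** Averaging 2 r |y| <= y^2 + r^2 at time r^2 bounds E|y|, hence the visits, by the second
    moment. *)
Lemma visits_upper r : visits (r ^ 2)%N <= 2 * r%:R.
Proof.
case: r => [|r]; first by rewrite big_geq// mulr0.
set q : R := r.+1%:R; have q0 : 0 < q by rewrite ltr0n.
rewrite -(ler_pM2l q0).
have : expect (r.+1 ^ 2) (fun y => 2 * q * `|y|%:~R) <=
       expect (r.+1 ^ 2) (fun y => (y%:~R) ^+ 2 + q ^+ 2).
  apply: iter_step_le => y; rewrite intr_norm -[y%:~R ^+ 2]real_normK ?num_real//.
  by have := sqr_ge0 (`|y%:~R| - q); rewrite sqrrB; lra.
rewrite iter_stepZ iter_stepD iter_step_cst// expect_abs expect_sqr natrX -/q.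
have v0 : 0 <= visits (r.+1 ^ 2) by apply: sumr_ge0 => k _; exact: return_prob_ge0.
by lra.
Qed.

Lemma visits_lower r : (0 < r)%N -> 4 / 9 * r%:R - 2 / 3 <= visits (r ^ 2)%N.
Proof.
move=> r_gt0; set q : R := r%:R; have q0 : 0 < q by rewrite ltr0n.
(* t^4 - K^2 t^2 + K^3 t >= 0 for t >= 0 bounds E|y| below by the second and
   fourth moments; K = 3 r gives a positive multiple of r. *)
have : expect (r ^ 2) (fun y => (3 * q) ^+ 2 * (y%:~R) ^+ 2) <=
    expect (r ^ 2) (fun y => (3 * q) ^+ 3 * `|y|%:~R + (y%:~R) ^+ 4).
  apply: iter_step_le => y.
  have sq : (y%:~R) ^+ 2 = (`|y|%:~R) ^+ 2 :> R.
    by rewrite intr_norm real_normK ?num_real.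
  rewrite [y%:~R ^+ 4](exprM _ 2 2) sq -exprM.
  set t : R := `|y|%:~R; have t0 : 0 <= t by rewrite ler0z normr_ge0.
  have [tq|tq] := lerP t (3 * q).
    have h1 : t ^+ 2 <= 3 * q * t by rewrite expr2 ler_wpM2r.
    have h2 : (3 * q) ^+ 2 * t ^+ 2 <= (3 * q) ^+ 2 * (3 * q * t).
      by rewrite ler_wpM2l ?sqr_ge0.
    have h3 : 0 <= t ^+ 4 by rewrite exprn_ge0.
    by rewrite [(3 * q) ^+ 3]exprSr; lra.
  have h1 : (3 * q) ^+ 2 <= t ^+ 2 by rewrite lerXn2r ?nnegrE//; lra.
  have h2 : (3 * q) ^+ 2 * t ^+ 2 <= t ^+ 2 * t ^+ 2 by rewrite ler_wpM2r ?sqr_ge0.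
  have h3 : 0 <= (3 * q) ^+ 3 * t by rewrite mulr_ge0// exprn_ge0; lra.
  by rewrite [t ^+ 4](exprD t 2 2); lra.
rewrite iter_stepD !iter_stepZ expect_abs expect_sqr.
have := expect_fourth (r ^ 2); have := visits_upper r; rewrite natrX -/q.
set s := visits _ => su e4 H.
have {e4}H : (3 * q) ^+ 2 * (q ^+ 2 - s / 2) <= (3 * q) ^+ 3 * (s / 2) + 3 * (q ^+ 2) ^+ 2.
  by apply: le_trans H _; rewrite lerD2l.
have q3 : 0 < q ^+ 3 by rewrite exprn_gt0.
have H2 : q ^+ 2 * s <= q ^+ 2 * (2 * q) by rewrite ler_wpM2l ?sqr_ge0.
by rewrite -(ler_pM2l q3); lra.
Qed.

(** With r = 6^(j+1), the lower bound on visits before 36 r^2 exceeds the upper bound before r^2 by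
    at least r/2; a Cauchy-Schwarz argument passes to squares. *)
Lemma square_return_block j :
  1 / 144 <= \sum_(36 ^ j.+1 <= k < 36 ^ j.+2) (return_prob vert_move 0 k : R) ^+ 2.
Proof.
set r := (6 ^ j.+1)%N; have r6 : (6 <= r)%N by rewrite /r expnS leq_pmulr ?expn_gt0.
have E1 : (36 ^ j.+1 = r ^ 2)%N by rewrite /r -expnM mulnC expnM.
have E2 : (36 ^ j.+2 = (6 * r) ^ 2)%N by rewrite /r -expnS -expnM mulnC expnM.
set q : R := r%:R; have q6 : 6 <= q by rewrite ler_nat.
have q0 : 0 < q by lra.
(* In p^2 >= 2 lam p - lam^2 the best [lam] is the mean of p, here about r/2 over the block length
   35 r^2. *)
have [lam lq] : exists lam : R, lam * q = 1 / 72.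
  by exists (1 / 72 / q); rewrite divfK// gt_eqF.
have r12 : (r ^ 2 <= (6 * r) ^ 2)%N by rewrite leq_exp2r//; lia.
have up := visits_upper r.
have lo : 4 / 9 * (6 * r)%:R - 2 / 3 <= visits ((6 * r) ^ 2).
  by apply: visits_lower; lia.
rewrite (big_cat_nat (n := r ^ 2))//= natrM -/q in lo.
rewrite E1 E2.
apply: (@le_trans _ _ (\sum_(r ^ 2 <= k < (6 * r) ^ 2)
    (2 * lam * (return_prob vert_move 0 k : R) - lam ^+ 2))); last first.
  apply: ler_sum => k _; have := sqr_ge0 (return_prob vert_move 0 k - lam).
  by rewrite sqrrB; lra.
rewrite sumrB -mulr_sumr sumr_const_nat -(mulr_natr (lam ^+ 2)) natrB// (natrX R (6 * r) 2) (natrX R r 2) natrM -/q.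
set s := \sum_(r ^ 2 <= _ < _) _ in lo *.
have lam0 : 0 < lam by rewrite -(pmulr_lgt0 _ q0) lq; lra.
have s2 : q / 2 <= s by rewrite -/q in up; lra.
have ls : lam * (q / 2) <= lam * s by rewrite ler_wpM2l// ltW.
have lq2 : lam ^+ 2 * q ^+ 2 = 1 / 72 ^+ 2 by rewrite -exprMn lq; lra.
by lra.
Qed.

Lemma pair_visits_diverge (B : R) :
  exists n, B <= \sum_(k < n) return_prob (prod_move vert_move vert_move) (0, 0) k.
Proof.
have H j : j%:R / 144 <= \sum_(0 <= k < 36 ^ j.+1) (return_prob vert_move 0 k : R) ^+ 2.
  elim: j => [|j IH]; first by rewrite mul0r sumr_ge0// => k _; rewrite sqr_ge0.
  rewrite (big_cat_nat (n := 36 ^ j.+1))//= ?leq_exp2l//.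
  have := square_return_block j; rewrite -(natr1 j). lra.
pose j := Num.bound `|B * 144|; exists (36 ^ j.+1)%N.
rewrite -(big_mkord xpredT (fun k => return_prob _ _ k)).
under eq_bigr => k _ do rewrite return_prob_prod -expr2.
apply: le_trans (H j); rewrite ler_pdivlMr//; apply: le_trans (ler_norm _) _.
exact/ltW/archi_boundP/normr_ge0.
Qed.

End VerticalMoments.

(** * Exponential supermartingale for the horizontal gap *)

Section HorizontalGap.
Context {R : realType}.

(** Since 2 cosh x = (e^t - e^(-t))^2 + 2 with t = x/2, a linear bound on e^t - e^(-t) suffices;
    11/20 leaves room above 1/2. *)
Lemma cosh_le (x : R) : 0 <= x <= 1 / 20 ->
  expR x + expR (- x) <= 2 * expR (11 / 20 * x ^+ 2).
Proof.
move=> /andP[x0 x1]; set t := x / 2.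
have xt : x = t + t by rewrite /t; lra.
set u := expR t; set w := expR (- t).
have uw : u * w = 1 by rewrite /u /w -expRD subrr expR0.
have wt : 1 - t <= w by exact: expR_ge1Dx.
have u0 : 0 < u by exact: expR_gt0.
have u1 : u * (1 - t) <= 1 by have := wt; rewrite -(ler_pM2l u0) uw.
have ub : u <= 103 / 100 by nra.
have d0 : 0 <= u - w by rewrite subr_ge0 ler_expR; lra.
have d1 : u - w <= 203 / 100 * t by nra.
have d2 : (u - w) ^+ 2 <= (203 / 100 * t) ^+ 2 by rewrite lerXn2r ?nnegrE//; lra.
have -> : expR x + expR (- x) = (u - w) ^+ 2 + 2.
  rewrite {1 2}xt opprD !expRD -/u -/w; have := uw; rewrite sqrrB; lra.
apply: (@le_trans _ _ (2 * (1 + 11 / 20 * x ^+ 2))); last first.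
  by rewrite ler_pM2l// expR_ge1Dx.
by rewrite xt; have := sqr_ge0 t; lra.
Qed.

Definition comb_exp (theta : R) (u : vertex) : R :=
  expR (theta * u.1%:~R - 11 / 20 * theta ^+ 2 * `|u.2|%:~R).

(** Let a = 11/20 theta^2. Off the axis the growth factor is cosh a; on it, cosh theta <= e^a gives
    at most cosh a again. Then cosh a <= exp(11/20 a^2), and (11/20)^3 < 3/16. *)
Lemma step_comb_exp theta u : `|theta| <= 1 / 20 ->
  step comb_move (comb_exp theta) u <=
  expR (3 / 16 * theta ^+ 4) * comb_exp theta u.
Proof.
move=> ht; rewrite step_comb /comb_exp; case: u => x y /=.
set a := 11 / 20 * theta ^+ 2.
have sq : theta ^+ 2 = `|theta| ^+ 2 by rewrite real_normK ?num_real.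
have n0 : 0 <= `|theta| by [].
have a01 : 0 <= a <= 1 / 20.
  by rewrite /a sq; apply/andP; split; nra.
have cosh_a : expR a + expR (- a) <= 2 * expR (3 / 16 * theta ^+ 4).
  apply: le_trans (cosh_le _ a01) _; rewrite ler_pM2l// ler_expR /a exprMn.
  have : 0 <= theta ^+ 4 by rewrite exprn_even_ge0.
  by rewrite -exprM; lra.
set e := expR (theta * x%:~R).
have e0 : 0 < e by exact: expR_gt0.
case: eqVneq => [->|y0] /=.
  rewrite normr0 normrN normr1 mulr0z mulr0 !subr0 mulr1z mulr1 !intrD.
  rewrite mulrDr mulrBr mulr1 !expRD -/e.
  have cosh_t : expR theta + expR (- theta) <= 2 * expR a.
    rewrite /a sq; have [t0|t0] := lerP 0 theta.
      by rewrite ger0_norm ?cosh_le// t0 -(ger0_norm t0).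
    rewrite addrC -[X in _ + expR X <= _]opprK ltr0_norm// cosh_le//.
    by rewrite -(ltr0_norm t0) n0.
  have -> : (e * expR theta + e * expR (- theta) + e * expR (- a) + e * expR (- a)) / 4
    = e * ((expR theta + expR (- theta) + 2 * expR (- a)) / 4) by lra.
  rewrite [leRHS]mulrC ler_pM2l//; lra.
rewrite (_ : expR _ + expR _ = e * expR (- (a * `|y|%:~R)) * (expR a + expR (- a))).
  rewrite expRD -/e; set b := e * _; have b0 : 0 < b by rewrite mulr_gt0 ?expR_gt0.
  by rewrite mulrAC -mulrA [leRHS]mulrC ler_pM2l//; lra.
rewrite mulrDr -!expRD.
have [yp|yn] := ltP 0 y.
  have -> : `|y + 1| = `|y| + 1 by lia.
  have -> : `|y - 1| = `|y| - 1 by lia.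
  by rewrite addrC !intrD; congr (expR _ + expR _); lra.
have -> : `|y + 1| = `|y| - 1 by lia.
have -> : `|y - 1| = `|y| + 1 by lia.
by rewrite !intrD; congr (expR _ + expR _); lra.
Qed.

Definition gap_exceeds (X : R) (u : vertex * vertex) : bool :=
  [&& u.1.2 == 0, u.2.2 == 0 & X < `|u.1.1 - u.2.1|%:~R].

Lemma axis_gap_bound (n : nat) (theta X : R) : 0 <= theta <= 1 / 20 ->
  1 - stay (prod_move comb_move comb_move) (fun _ u => ~~ gap_exceeds X u)
        n.*2 0 ((0, 0), (0, 0)) <=
  2 * expR (3 / 4 * theta ^+ 4 * n%:R - theta * X).
Proof.
move=> /andP[t0 t1].
have ht : `|theta| <= 1 / 20 by rewrite ger0_norm.
have hnt : `|- theta| <= 1 / 20 by rewrite normrN.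
(* Opposite tilts of the two walks produce an exponential of their gap; [M] adds both signs of the
   tilt to control the absolute value. *)
pose G (s : R) (u : vertex * vertex) := comb_exp s u.1 * comb_exp (- s) u.2.
(* The discount offsets the growth 3/8 theta^4 per step, and is scaled so that [M] is at least 1 at
   a gap above [X] up to time 2 n. *)
pose c k : R := expR (3 / 8 * theta ^+ 4 * (n.*2%:R - k%:R) - theta * X).
have G0 s u : 0 <= G s u by rewrite mulr_ge0 ?expR_ge0.
have c0 k : 0 <= c k by exact: expR_ge0.
have stepG s u : `|s| <= 1 / 20 ->
    step (prod_move comb_move comb_move) (G s) u <= expR (3 / 8 * s ^+ 4) * G s u.
  move=> hs; rewrite step_prod.
  apply: le_trans (ler_pM _ _ (step_comb_exp _ u.1 hs) (step_comb_exp (- s) u.2 _)) _.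
  - by apply: step_ge0 => v; exact: expR_ge0.
  - by apply: step_ge0 => v; exact: expR_ge0.
  - by rewrite normrN.
  rewrite mulrACA -expRD (ler_wpM2r (G0 s u))// ler_expR; lra.
pose M k u := c k * (G theta u + G (- theta) u).
apply: (@le_trans _ _ (M 0%N ((0, 0), (0, 0)))).
  apply: (stay_supermartingale _ _ M _ n.*2); rewrite ?add0n//.
  - by rewrite card_prod card_ord.
  - by move=> k u; rewrite mulr_ge0 ?addr_ge0.
  - move=> k u kn; rewrite /M stepZ stepD.
    have ck : c k = c k.+1 * expR (3 / 8 * theta ^+ 4).
      by rewrite /c -expRD -natr1; congr expR; lra.
    rewrite ck -mulrA ler_wpM2l// mulrDr lerD ?stepG//.
    by have := stepG (- theta) u hnt; rewrite (_ : (- theta) ^+ 4 = theta ^+ 4)//; lra.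
  move=> k [[x1 y1] [x2 y2]] kn; rewrite negbK => /and3P[/= /eqP -> /eqP ->] gap.
  rewrite /M /G /comb_exp /= normr0 opprK !mulr0 !subr0 -!expRD.
  have th4 : 0 <= theta ^+ 4 by rewrite exprn_ge0.
  have c1 : 0 <= 3 / 8 * theta ^+ 4 * (n.*2%:R - k%:R) :> R.
    by rewrite !mulr_ge0// subr_ge0 ler_nat.
  rewrite intr_norm intrD intrN in gap.
  set D : R := x1%:~R - x2%:~R in gap.
  have gap_exp : expR (theta * `|D|) <=
      expR (theta * x1%:~R + - theta * x2%:~R) +
      expR (- theta * x1%:~R + theta * x2%:~R).
    have [D0|D0] := lerP 0 D.
      rewrite ger0_norm// (_ : theta * D = theta * x1%:~R + - theta * x2%:~R).
        by rewrite lerDl expR_ge0.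
      by rewrite /D; lra.
    rewrite ltr0_norm// (_ : theta * - D = - theta * x1%:~R + theta * x2%:~R).
      by rewrite lerDr expR_ge0.
    by rewrite /D; lra.
  apply: le_trans (ler_wpM2l (c0 k) gap_exp).
  rewrite /c -expRD -[leLHS]expR0 ler_expR.
  have : theta * X <= theta * `|D| by rewrite ler_wpM2l// ltW.
  by lra.
rewrite /M /G /comb_exp /= normr0 !mulr0 subr0 expR0 mulr1 /c subr0 -muln2 natrM.
by rewrite mulrC ler_pM// ?expR_ge0// ?ler_expR; lra.
Qed.

End HorizontalGap.

(** * Logarithmic scales and the summable bound over dyadic blocks *)

Section LogScale.
Context {R : realType}.

Lemma ln2_ge_half : 1 / 2 <= ln 2 :> R.
Proof.
rewrite -[leLHS]expRK ler_ln ?posrE ?expR_gt0//.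
have := expR_ge1Dx (- (1 / 2) : R); have : expR (1 / 2) * expR (- (1 / 2)) = 1 :> R.
  by rewrite -expRD subrr expR0.
have := expR_gt0 (1 / 2 : R); nra.
Qed.

Lemma ln2_le1 : ln 2 <= 1 :> R.
Proof.
rewrite -[leRHS]expRK ler_ln ?posrE ?expR_gt0//.
by apply: le_trans (expR_ge1Dx _); lra.
Qed.

(* 2 n^(1/4) (ln ln n)^(3/4), in exponential form *)
Definition gap_scale (n : nat) : R :=
  2 * expR (ln n%:R / 4 + 3 / 4 * ln (ln (ln n%:R))).

Lemma ln_exp2 j : ln (2 ^ j)%:R = j%:R * ln 2 :> R.
Proof. by rewrite natrX lnXn// mulr_natl. Qed.

Lemma lnln_gt0 j : (24 <= j)%N -> 0 < ln (ln (2 ^ j)%:R) :> R.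
Proof.
move=> j24; apply: ln_gt0; rewrite ln_exp2.
have j24' : 24 <= j%:R :> R by rewrite (ler_nat _ 24).
have := ln2_ge_half; nra.
Qed.

(** Serves to make theta^4 at most 2^(-18), which is below 20^(-4). *)
Lemma expn_large j : (24 <= j)%N -> (j * 2 ^ 18 <= 2 ^ j)%N.
Proof.
elim: j => // j IH; rewrite leq_eqVlt => /orP[/eqP <-|].
  rewrite -[X in (_ <= 2 ^ X)%N]/(6 + 18)%N expnD.
  by rewrite leq_pmul2r ?expn_gt0.
rewrite ltnS => j24; rewrite (expnS 2 j) (mul2n (2 ^ j)) -addnn.
apply: leq_trans (leq_add (IH j24) (IH j24)); rewrite -mulnDl.
by rewrite leq_pmul2r ?expn_gt0//; lia.
Qed.

(** With n = 2^j, L = ln ln n and theta^4 = L / n, the exponent is 3/4 L - 2 L = -5/4 L, and L = ln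
    j + ln ln 2. *)
Lemma block_bound j : (24 <= j)%N ->
  exists theta : R, 0 <= theta <= 1 / 20 /\
  2 * expR (3 / 4 * theta ^+ 4 * (2 ^ j)%:R - theta * gap_scale (2 ^ j)) <=
  8 * expR (- (5 / 4) * ln j%:R).
Proof.
move=> j24; have j24' : 24 <= j%:R :> R by rewrite (ler_nat _ 24).
have L0 := @lnln_gt0 _ j24; set n : R := (2 ^ j)%:R.
set L : R := ln (ln n).
have n0 : 0 < n by rewrite ltr0n expn_gt0.
pose theta : R := expR ((ln L - ln n) / 4).
have th4 : theta ^+ 4 = L / n.
  rewrite /theta -expRM_natl (_ : _ * _ = ln L - ln n); last by lra.
  by rewrite expRD expRN !lnK ?posrE.
have thX : theta * gap_scale (2 ^ j) = 2 * L.
  rewrite /gap_scale -/n -/L mulrCA -expRD (_ : _ + _ = ln L); last by lra.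
  by rewrite lnK ?posrE.
have hln2 := ln2_ge_half; have hln2' := ln2_le1.
have lnnj : ln n = j%:R * ln 2 by exact: ln_exp2.
have lnn0 : 0 < ln n by rewrite lnnj; nra.
exists theta; split.
  rewrite expR_ge0/= -(@ler_pXn2r _ 4)// ?nnegrE ?expR_ge0// th4.
  rewrite ler_pdivrMr//.
  have Lj : L <= j%:R.
    apply: le_trans (_ : ln n <= _); last by rewrite lnnj; nra.
    exact/ltW/ln_sublinear.
  have : (j * 2 ^ 18)%:R <= n by rewrite ler_nat expn_large.
  rewrite natrM natrX; lra.
rewrite thX th4 mulrA divfK ?gt_eqF//.
have -> : 3 / 4 * L - 2 * L = - (5 / 4) * ln j%:R + - (5 / 4) * ln (ln 2).
  rewrite /L lnnj lnM ?posrE; [lra | lra | lra].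
rewrite expRD mulrCA [leRHS]mulrC ler_pM2l ?expR_gt0//.
(* The term ln ln 2 costs at most a factor exp(5/4 ln 2) <= 4, whence the constant 8. *)
have lnln2 : - ln 2 <= ln (ln 2) :> R.
  rewrite -lnV ?posrE// ler_ln ?posrE; lra.
apply: (@le_trans _ _ (2 * expR (ln 2 + ln 2))).
  rewrite ler_pM2l// ler_expR; lra.
by rewrite expRD lnK ?posrE//; lra.
Qed.

(** Algebraic form of the integral test for the exponent 5/4, with a = x^(-1/4) and b =
    (x+1)^(-1/4): a^4 b^4 = a^4 - b^4 <= 4 a^3 (a - b), and a^3 cancels. *)
Lemma fifth_power_secant (x a b : R) : 0 < b -> b <= a ->
  x * a ^+ 4 = 1 -> (x + 1) * b ^+ 4 = 1 -> b ^+ 5 <= 4 * (a - b).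
Proof.
move=> b0 ba xa xb; have a0 := lt_le_trans b0 ba.
have b2 : b ^+ 2 <= a ^+ 2 by rewrite lerXn2r// nnegrE ltW.
have b3 : b ^+ 3 <= a ^+ 3 by rewrite lerXn2r// nnegrE ltW.
have b4 : 0 <= b ^+ 4 by rewrite exprn_ge0 ?ltW.
have ab2 : a * b ^+ 2 <= a * a ^+ 2 by rewrite ler_pM2l.
have a2b : a ^+ 2 * b <= a ^+ 2 * a by rewrite ler_pM2l ?exprn_gt0.
have key : a ^+ 4 * b ^+ 4 = a ^+ 4 - b ^+ 4.
  have -> : a ^+ 4 * b ^+ 4 = a ^+ 4 * ((x + 1) * b ^+ 4) - x * a ^+ 4 * b ^+ 4.
    by ring.
  by rewrite xa xb mulr1 mul1r.
have secant : a ^+ 4 - b ^+ 4 <= 4 * a ^+ 3 * (a - b).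
  have -> : a ^+ 4 - b ^+ 4 =
      (a ^+ 3 + a ^+ 2 * b + a * b ^+ 2 + b ^+ 3) * (a - b) by ring.
  apply: ler_wpM2r; first by rewrite subr_ge0.
  by lra.
have a3 : 0 < a ^+ 3 by rewrite exprn_gt0.
have H : a ^+ 3 * (a * b ^+ 4) <= a ^+ 3 * (4 * (a - b)).
  rewrite mulrA -exprSr key; apply: le_trans secant _.
  by rewrite (mulrC 4) -mulrA.
rewrite (ler_pM2l a3) in H; apply: le_trans H.
by rewrite exprS ler_wpM2r.
Qed.

Lemma quarter_power_telescope j : (0 < j)%N ->
  expR (- (5 / 4) * ln j.+1%:R) <=
  4 * (expR (- (ln j%:R / 4)) - expR (- (ln j.+1%:R / 4))) :> R.
Proof.
move=> j0.
have s4 k : (0 < k)%N -> k%:R * expR (- (ln k%:R / 4)) ^+ 4 = 1 :> R.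
  move=> k0; rewrite -expRM_natl (_ : 4%:R * _ = - ln k%:R); last by lra.
  by rewrite expRN lnK ?posrE ?ltr0n// divff// pnatr_eq0 -lt0n.
have -> : expR (- (5 / 4) * ln j.+1%:R) = expR (- (ln j.+1%:R / 4)) ^+ 5 :> R.
  by rewrite -expRM_natl; congr expR; lra.
apply: (@fifth_power_secant j%:R); [exact: expR_gt0 | | exact: s4 | ].
  by rewrite ler_expR lerN2 ler_pM2r ?invr_gt0// ler_ln ?posrE ?ltr0n// ler_nat.
by have := s4 j.+1 isT; rewrite -[X in X * _]natr1.
Qed.

Lemma quarter_power_sum (delta : R) : 0 < delta -> exists J0, forall J K,
  (J0 <= J)%N -> \sum_(J <= j < K) 8 * expR (- (5 / 4) * ln j%:R) <= delta.
Proof.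
(* [x] solves 32 exp(- x/4) = delta, where 32 = 8 * 4 is the constant of the telescoped sum. *)
move=> d0; pose x : R := 4 * ln (32 / delta).
have [N xN] : exists N : nat, expR x <= N%:R.
  exists (Num.bound (expR x)); exact/ltW/archi_boundP/expR_ge0.
(* The telescoped bound starts at J - 1, which must be positive and at least [N]. *)
exists N.+2 => J K NJ.
have [KJ|JK] := leqP K J; first by rewrite big_geq// ltW.
case: J NJ JK => // J NJ JK.
apply: (@le_trans _ _ (32 * (expR (- (ln J%:R / 4)) - expR (- (ln K.-1%:R / 4))))).
  elim: K JK => // K IH; rewrite ltnS leq_eqVlt => /orP[/eqP <-|JK].
    rewrite big_nat1.
    have := @quarter_power_telescope J _; rewrite /=; have -> : (0 < J)%N by lia.
    by move=> /(_ isT); lra.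
  rewrite big_nat_recr ?(ltnW JK)//=.
  have := @quarter_power_telescope K.-1 _; have K0 : (0 < K.-1)%N by lia.
  rewrite prednK; last by lia.
  by move=> /(_ K0); have := IH JK; lra.
have : expR (- (ln J%:R / 4)) <= delta / 32; last first.
  by have := expR_gt0 (- (ln K.-1%:R / 4) : R); lra.
have J0 : 0 < J%:R :> R by rewrite ltr0n; lia.
have xJ : x <= ln J%:R.
  rewrite -[leLHS]expRK ler_ln ?posrE ?expR_gt0//; apply: le_trans xN _.
  by rewrite ler_nat; lia.
rewrite -[leRHS]lnK ?posrE ?divr_gt0// ler_expR.
have : ln (32 / delta) = - ln (delta / 32) by rewrite -lnV ?posrE ?divr_gt0// invf_div.
rewrite /x in xJ; lra.
Qed.

(** The scale increases with time, and 2 <= 2^(9/4) / 3^(3/4) amounts to 27 <= 32. *)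
Lemma gap_scale_le (eps : R) j m : 0 < eps -> (24 <= j)%N -> (2 ^ j <= m)%N ->
  gap_scale (2 ^ j) <= (1 + eps) * (2 `^ (9 / 4) / 3 `^ (3 / 4))
                * m%:R `^ (1 / 4) * ln (ln m%:R) `^ (3 / 4).
Proof.
move=> e0 j24 jm; have L0 := @lnln_gt0 _ j24.
set n : R := (2 ^ j)%:R in L0.
have n0 : 0 < n by rewrite ltr0n expn_gt0.
have nm : n <= m%:R by rewrite ler_nat.
have m0 : 0 < m%:R :> R by exact: lt_le_trans nm.
have lnn0 : 0 < ln n.
  rewrite /n ln_exp2 mulr_gt0 ?ltr0n//; first by lia.
  by have := ln2_ge_half; lra.
have lnnm : ln n <= ln m%:R by rewrite ler_ln.
have lnm0 : 0 < ln m%:R :> R by exact: lt_le_trans lnnm.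
have Lm : ln (ln n) <= ln (ln m%:R) by rewrite ler_ln.
have Lm0 : 0 < ln (ln m%:R) :> R by exact: lt_le_trans Lm.
have c2 : 2 <= 2 `^ (9 / 4) / 3 `^ (3 / 4) :> R.
  rewrite /powR !pnatr_eq0/= -expRN -expRD -[leLHS]lnK ?posrE// ler_expR.
  have : ln (3 ^+ 3) <= ln (2 ^+ 5) :> R by rewrite ler_ln ?posrE//; lra.
  by rewrite (lnXn 3)// (lnXn 5)//; lra.
have p1 : expR (ln n / 4) <= m%:R `^ (1 / 4).
  rewrite /powR gt_eqF// ler_expR; lra.
have p2 : expR (3 / 4 * ln (ln (ln n))) <= ln (ln m%:R) `^ (3 / 4).
  rewrite /powR gt_eqF// ler_expR ler_pM2l; last by lra.
  by rewrite ler_ln.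
rewrite /gap_scale -/n expRD mulrA ler_pM ?mulr_ge0 ?expR_ge0//.
rewrite ler_pM ?expR_ge0//; nra.
Qed.

End LogScale.

(** The straight walk along the axis has this length. *)
Lemma comb_dist_axis (x x' : int) : (comb_dist (x, 0%R) (x', 0%R) <= `|x - x'|)%N.
Proof.
have [_ min_dist] := @graph_distP _ comb_adj (x, 0) (x', 0) (comb_connected _ _).
apply: min_dist; move: {2}`|x - x'|%N (erefl `|x - x'|%N) => n.
elim: n x => [|n IH] x xn.
  by exists [::]; split; rewrite //= ?xn//; congr (_, _); lia.
pose x1 := if x < x' then x + 1 else x - 1.
have x1n : `|x1 - x'|%N = n by rewrite /x1; case: ifP; lia.
have [p [xp pl sp]] := IH x1 x1n.
exists ((x1, 0) :: p); split; rewrite /= ?xp ?pl//; last by rewrite sp x1n xn.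
by rewrite andbT /comb_adj /grid_adj /x1 /=; case: ifP; lia.
Qed.

(** * The pair of independent comb walks *)

Section IndependentPair.
Context {d : measure_display} {T : measurableType d} {R : realType}.
Variables (P : probability T R) (C1 C2 : nat -> T -> vertex).
Hypotheses (hC1 : comb_walk P C1) (hC2 : comb_walk P C2).
Hypothesis hind : independent_processes P C1 C2.

Let pair (n : nat) (w : T) : vertex * vertex := (C1 n w, C2 n w).

Lemma sigma_process_coordinate (C : nat -> T -> vertex) n v :
  sigma_process C (C n @^-1` [set v]).
Proof. by apply: sub_gen_smallest; exists n, v. Qed.

Lemma sigma_process_path (C : nat -> T -> vertex) z n :
  sigma_process C (path_event C z n).
Proof.
pose G := [set A | exists n v, A = C n @^-1` [set v]].
have -> : path_event C z n =
    \bigcap_(k in [set k | (k <= n)%N]) (C k @^-1` [set z k]).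
  by apply/seteqP; split => w.
apply: (@bigcap_measurableType _ (g_sigma_algebraType G)) => k _.
exact: sigma_process_coordinate.
Qed.

Lemma measurable_pair n v : measurable (pair n @^-1` [set v]).
Proof.
have [m1 _ _] := hC1; have [m2 _ _] := hC2.
have -> : pair n @^-1` [set v] = C1 n @^-1` [set v.1] `&` C2 n @^-1` [set v.2].
  apply/seteqP; split => w /=; first by move=> <-.
  by move=> [e1 e2]; rewrite /pair e1 e2; case: v {e1 e2}.
exact: measurableI.
Qed.

Lemma pair_start : P (pair 0 @^-1` [set ((0, 0), (0, 0))]) = 1%E.
Proof.
have [_ s1 _] := hC1; have [_ s2 _] := hC2.
have -> : pair 0 @^-1` [set ((0, 0), (0, 0))] =
    C1 0%N @^-1` [set (0, 0)] `&` C2 0%N @^-1` [set (0, 0)].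
  apply/seteqP; split => w /=; first by case.
  by move=> [e1 e2]; rewrite /pair e1 e2.
by rewrite hind ?s1 ?s2 ?mule1//; exact: sigma_process_coordinate.
Qed.

Lemma pair_transition n z : P (path_set pair z n.+1) = (P (path_set pair z n) *
  (step (prod_move comb_move comb_move) (fun v => (v == z n.+1)%:R) (z n))%:E)%E.
Proof.
have [_ _ t1] := hC1; have [_ _ t2] := hC2.
have path2 k : path_set pair z k =
    path_event C1 (fun j => (z j).1) k `&` path_event C2 (fun j => (z j).2) k.
  apply/seteqP; split => w /=.
    by move=> zw; split => j jk; rewrite -(zw j jk).
  move=> [z1 z2] j jk; rewrite /pair z1// z2//; by case: (z j).
rewrite !path2 !hind ?t1 ?t2; try exact: sigma_process_path.
rewrite muleACA; congr (_ * _)%E.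
rewrite !comb_transE -EFinM -step_prod; congr (_%:E); apply: step_ext => v.
by rewrite -natrM mulnb -xpair_eqE -!surjective_pairing.
Qed.

Lemma pair_stay A m : P (stay_set pair A 0 m) =
  (stay (prod_move comb_move comb_move) A m 0 ((0, 0), (0, 0)))%:E.
Proof.
apply: stay_probability.
- by rewrite card_prod card_ord.
- exact: measurable_pair.
- exact: pair_start.
- exact: pair_transition.
Qed.

Definition both_on_axis (u : vertex * vertex) : bool := (u.1.2 == 0) && (u.2.2 == 0).

(** Projection to the vertical coordinates turns the event into avoidance of (0, 0) from time [N]
    on, to which [recurrent_avoid] applies. *)
Lemma axis_meeting (N : nat) (delta : R) : 0 < delta ->
  exists m0, forall m, (m0 <= m)%N ->
  (P (stay_set pair (fun k u => (k < N)%N || ~~ both_on_axis u) 0 (N + m)) <=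
   delta%:E)%E.
Proof.
move=> d0.
have I44 : (0 < #|{: 'I_4 * 'I_4}|)%N by rewrite card_prod card_ord.
have [m0 Hm0] := recurrent_avoid (prod_move vert_move vert_move) I44 (0, 0) N delta
  d0 pair_visits_diverge.
exists m0 => m mm0; rewrite pair_stay lee_fin; apply: le_trans (Hm0 m mm0).
pose pi (u : vertex * vertex) := (u.1.2, u.2.2).
pose A k (v : int * int) := (k < N)%N || (v != (0, 0)).
rewrite (stay_ext _ _ (fun k u => A k (pi u))); last first.
  by move=> k u; rewrite /A /pi xpair_eqE.
rewrite (stay_proj _ (prod_move vert_move vert_move) pi); last first.
  by move=> u i; rewrite /pi /prod_move /= !comb_move_vert.
have := @stay_delayed R _ _ (prod_move vert_move vert_move)
  (fun _ v => v != (0, 0)) N m 0 (0, 0).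
rewrite add0n /A /pi /= => ->; rewrite le_eqVlt; apply/orP; left; apply/eqP.
by apply: iter_step_ext => v; exact: stay_homogeneous.
Qed.

Lemma block_gap j : (24 <= j)%N ->
  (P (~` stay_set pair (fun _ u => ~~ gap_exceeds (gap_scale (2 ^ j) : R) u)
     0 (2 ^ j).*2) <= (8 * expR (- (5 / 4) * ln j%:R))%:E)%E.
Proof.
move=> j24; have [theta [th le8]] := @block_bound R _ j24.
rewrite probability_setC; last exact/measurable_stay_set/measurable_pair.
rewrite pair_stay -EFinB lee_fin; apply: le_trans le8.
exact: axis_gap_bound.
Qed.

(** On this event, either the walks never share the axis at times from 2^J to 2^K - 1, or in some
    block J <= j < K they share it with too large a gap. Each alternative has probability at most
    delta / 2. *)
Lemma no_close_meeting (f : nat -> R) (N : nat) :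
  (forall j m, (24 <= j)%N -> (2 ^ j <= m)%N -> gap_scale (2 ^ j) <= f m) ->
  P (~` \bigcup_(m in [set m | (N <= m)%N])
      [set w | (comb_dist (C1 m w) (C2 m w))%:R <= f m]) = 0%E.
Proof.
move=> fscale; set E := ~` _.
have mE : measurable E.
  apply: measurableC; apply: bigcup_measurable => m _.
  exact: (measurable_chain pair measurable_pair m
    (fun u => (comb_dist u.1 u.2)%:R <= f m)).
apply/eqP; rewrite -measure_le0; apply/lee_addgt0Pr => delta d0; rewrite add0e.
have d2 : 0 < delta / 2 by rewrite divr_gt0.
have [J0 HJ0] := quarter_power_sum _ d2.
(* The summands make the tail sum small, put the window beyond [N], and make the block bounds
   applicable. *)
pose J := (J0 + N + 24)%N.
have [m0 Hm0] := axis_meeting (2 ^ J) _ d2.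
pose K := (J + m0).+1.
have JK : (2 ^ J + m0 < 2 ^ K)%N.
  have : (m0 < 2 ^ m0)%N by exact: ltn_expl.
  have : (1 <= 2 ^ J)%N by rewrite expn_gt0.
  rewrite /K expnS expnD; nia.
(* The window ends at 2^K - 1, so each of its times has dyadic index below [K]. *)
pose m := (2 ^ K - 1 - 2 ^ J)%N; have mm0 : (m0 <= m)%N by rewrite /m; lia.
pose S0 := stay_set pair (fun k u => (k < 2 ^ J)%N || ~~ both_on_axis u) 0 (2 ^ J + m).
pose S j : set T := if (J <= j)%N then ~` stay_set pair
  (fun _ u => ~~ gap_exceeds (gap_scale (2 ^ j) : R) u) 0 (2 ^ j).*2 else set0.
have mS j : measurable (S j).
  by rewrite /S; case: ifP => // _; apply/measurableC/measurable_stay_set/measurable_pair.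
have mS0 : measurable S0 by exact/measurable_stay_set/measurable_pair.
have mU : measurable (\big[setU/set0]_(j < K) S j) by exact: bigsetU_measurable.
have sub : E `<=` S0 `|` \big[setU/set0]_(j < K) S j.
  move=> w Ew; have [S0w|nS0w] := pselect (S0 w); [by left | right].
  have [k [kT kJ axis]] : exists k, [/\ (k <= 2 ^ J + m)%N, (2 ^ J <= k)%N
      & both_on_axis (pair k w)].
    apply: contrapT => no; apply: nS0w => k /andP[_ kT].
    case: ltnP => //= Jk; apply/negP => ax; apply: no; exists k; split => //.
  have k0 : (0 < k)%N by apply: leq_trans kJ; rewrite expn_gt0.
  have [lo hi] := andP (trunc_log_bounds (isT : 1 < 2)%N k0).
  set j := trunc_log 2 k in lo hi.
  have Jj : (J <= j)%N by rewrite -ltnS -(ltn_exp2l _ _ (isT : 1 < 2)%N); lia.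
  have jK : (j < K)%N by rewrite -(ltn_exp2l _ _ (isT : 1 < 2)%N) /m in kT *; lia.
  rewrite -bigcup_mkord; exists j => //=; rewrite /S Jj => stay_j.
  have k2 : (0 <= k <= 0 + (2 ^ j).*2)%N by rewrite -mul2n -expnS; lia.
  have := stay_j k k2; rewrite /gap_exceeds; case/andP: axis => a1 a2.
  rewrite a1 a2 /= => /negP; apply.
  have Nk : (N <= k)%N.
    apply: leq_trans kJ; apply: leq_trans (ltnW (ltn_expl J _)) => //.
    by rewrite /J; lia.
  have fk : gap_scale (2 ^ j) <= f k by apply: fscale => //; rewrite /J in Jj; lia.
  apply: le_lt_trans fk _; rewrite ltNge; apply/negP => close; apply: Ew.
  exists k => //=; apply: le_trans close.
  rewrite /pair /= in a1 a2 *.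
  case: (C1 k w) (C2 k w) a1 a2 => [x y] [x' y'] /= /eqP -> /eqP ->.
  rewrite -[leRHS]/((`|x - x'|%N : int)%:~R) -pmulrn ler_nat; exact: comb_dist_axis.
apply: (@le_trans _ _ (P (S0 `|` \big[setU/set0]_(j < K) S j))).
  by apply: le_measure; rewrite ?inE//; exact: measurableU.
apply: le_trans (measureU2 _ mS0 mU) _.
have -> : delta%:E = ((delta / 2)%:E + (delta / 2)%:E)%E by rewrite -EFinD -splitr.
apply: leeD; first exact: Hm0.
apply: (@le_trans _ _ (\sum_(j < K) P (S j))%E).
  by apply: content_subadditive => //; rewrite bigcup_mkord.
rewrite -(big_mkord xpredT (fun j => P (S j))).
have JK' : (J <= K)%N by rewrite /K; lia.
rewrite (big_cat_nat (n := J))//= big1_seq ?add0e; last first.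
  move=> j /=; rewrite mem_index_iota => /andP[_ jJ].
  by rewrite /S leqNgt jJ /= measure0.
apply: (@le_trans _ _ (\sum_(J <= j < K) (8 * expR (- (5 / 4) * ln j%:R))%:E)%E).
  rewrite big_nat_cond [leRHS]big_nat_cond; apply: lee_sum => j.
  rewrite andbT => /andP[Jj _]; rewrite /S Jj; apply: block_gap.
  by rewrite /J in Jj; lia.
by rewrite sumEFin lee_fin HJ0// /J; lia.
Qed.

End IndependentPair.

Theorem theorem4p2 (R : realType) (d : measure_display) (T : measurableType d)
    (P : probability T R) (C1 C2 : nat -> T -> vertex)
    (hC1 : comb_walk P C1) (hC2 : comb_walk P C2)
    (hind : independent_processes P C1 C2)
    (eps : R) (heps : 0 < eps) :
  P (lim_sup_set (fun n : nat =>
       [set w | (comb_dist (C1 n w) (C2 n w))%:R <=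
                (1 + eps) * (2 `^ (9 / 4) / 3 `^ (3 / 4))
                * n%:R `^ (1 / 4) * ln (ln n%:R) `^ (3 / 4)])) = 1%E.
Proof.
set F := fun n : nat => _.
have mF n : measurable (F n).
  exact: (measurable_chain _ (measurable_pair P C1 C2 hC1 hC2) n
    (fun u => (comb_dist u.1 u.2)%:R <= _)).
have PF N : P (\bigcup_(m in [set m | (N <= m)%N]) F m) = 1%E.
  have mU : measurable (\bigcup_(m in [set m | (N <= m)%N]) F m).
    by apply: bigcup_measurable.
  have := no_close_meeting P C1 C2 hC1 hC2 hind
    (fun n => (1 + eps) * (2 `^ (9 / 4) / 3 `^ (3 / 4)) * n%:R `^ (1 / 4) *
      ln (ln n%:R) `^ (3 / 4)) N (fun j m => @gap_scale_le R eps j m heps).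
  rewrite -/F => null; rewrite -(setCK (\bigcup_(m in _) _)) probability_setC.
    by rewrite [X in (_ - X)%E]null sube0.
  exact: measurableC.
(* Continuity from above: the tail unions decrease to the limit superior and all have probability
   1. *)
have := lim_sup_set_cvg P F.
rewrite (_ : (fun n => P _) = fun=> 1%E); last by apply/funext.
move=> /(_ mF); rewrite [X in (X < _)%E]PF ltry => /(_ isT) cvF.
by apply: esym; apply: (cvg_unique _ _ cvF) => //; exact: cvg_cst.
Qed.
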